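(* Let $X\subset\mathbb{P}^1\times\mathbb{P}^1$ be a nonempty finite set of points. If all vertical rulings that contain at least one point of $X$ contain the same number of points of $X$, or if all horizontal rulings that contain at least one point of $X$ contain the same number of points of $X$, then $X$ is a virtual complete intersection.
   Context: Let $\Bbbk$ be an algebraically closed field; $\mathbb{P}^1\times\mathbb{P}^1$ is over $\Bbbk$, with projections $\pi_1,\pi_2$ to the first and second factor. A vertical ruling is a fiber of $\pi_1$ and a horizontal ruling is a fiber of $\pi_2$. The Cox ring is $S=\Bbbk[x_0,x_1,y_0,y_1]$, $\mathbb{Z}^2$-graded with $\deg x_i=(1,0)$ and $\deg y_i=(0,1)$, and $B=\langle x_0,x_1\rangle\cap\langle y_0,y_1\rangle$ is the irrelevant ideal. A set of points means a reduced zero-dimensional subscheme $X$ of $\mathbb{P}^1\times\mathbb{P}^1$; $I_X\subset S$ is the $B$-saturated bihomogeneous ideal of polynomials vanishing on $X$. A virtual resolution of $S/I$ ($I$ a bihomogeneous ideal) is a $\mathbb{Z}^2$-graded complex of free $S$-modules $F_\bullet=[F_0\xleftarrow{\varphi_1}F_1\xleftarrow{\varphi_2}F_2\leftarrow\cdots]$ such that for every $i\ge 1$ the annihilator of $H_i(F_\bullet)$ contains $B^\ell$ for some $\ell>0$, and the sheaves on $\mathbb{P}^1\times\mathbb{P}^1$ associated to $S/I$ and $\operatorname{coker}(\varphi_1)$ are isomorphic. The set $X$ is a virtual complete intersection (VCI) if $S/I_X$ has a virtual resolution that is the Koszul complex $K(f,g)$ of two bihomogeneous forms $f,g\in S$.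 *)

(* Defs.v *)
From HB Require Import structures.
From mathcomp Require Import all_boot all_order all_algebra finmap mpoly.

Set Implicit Arguments.
Unset Strict Implicit.
Unset Printing Implicit Defensive.

Import GRing.Theory.
Local Open Scope ring_scope.

(* Points of P^1 are lines through the origin of k^2.  As k is algebraically
   closed, these are the closed points, which is all that is needed below. *)
Notation P1 k := {L : {vspace 'rV[k]_2} | \dim L == 1%N}.
Notation P1xP1 k := (P1 k * P1 k)%type.

Definition vertical_count (k : closedFieldType) (X : {fset P1xP1 k}) (p : P1 k)
  : nat := #|` [fset x in X | x.1 == p] |%fset.

Definition horizontal_count (k : closedFieldType) (X : {fset P1xP1 k})
  (q : P1 k) : nat := #|` [fset x in X | x.2 == q] |%fset.

(* The variables are indexed by 'I_(2 + 2): x_i is the variable lshift 2 i and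
   y_j is the variable rshift 2 j. *)
Notation cox k := {mpoly k[(2 + 2)%N]}.

Definition xvar (k : closedFieldType) (i : 'I_2) : cox k := 'X_(lshift 2 i).
Definition yvar (k : closedFieldType) (j : 'I_2) : cox k := 'X_(rshift 2 j).

Definition bideg (m : 'X_{1..(2 + 2)%N}) : int * int :=
  (Posz (\sum_(i < 2) m (lshift 2 i)), Posz (\sum_(j < 2) m (rshift 2 j))).

(* The zero polynomial is bihomogeneous of every bidegree, and it is the only
   one of bidegree d when d has a negative component. *)
Definition bihomog (k : closedFieldType) (d : int * int) (f : cox k) : Prop :=
  forall m, m \in msupp f -> bideg m = d.

Definition vanishes_at (k : closedFieldType) (f : cox k) (P : P1xP1 k) : Prop :=
  forall u v : 'rV[k]_2, u \in val P.1 -> v \in val P.2 -> u != 0 -> v != 0 ->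
  f.@[row_mx u v ord0] = 0.

(* A polynomial vanishing at all homogeneous coordinates of the points of X has
   all its bihomogeneous components vanishing on X, since k is infinite; so
   this is the saturated bihomogeneous ideal I_X. *)
Definition point_ideal (k : closedFieldType) (X : {fset P1xP1 k}) (f : cox k)
  : Prop := forall P, P \in X -> vanishes_at f P.

Definition ideal_gen (R : comNzRingType) (G : R -> Prop) (f : R) : Prop :=
  exists n (a g : 'I_n -> R),
    (forall i, G (g i)) /\ f = \sum_(i < n) a i * g i.

Definition ideal_mul (R : comNzRingType) (I J : R -> Prop) : R -> Prop :=
  ideal_gen (fun f => exists a b, [/\ I a, J b & f = a * b]).

Fixpoint ideal_pow (R : comNzRingType) (I : R -> Prop) (n : nat) : R -> Prop :=
  if n is n'.+1 then ideal_mul I (ideal_pow I n') else fun=> True.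

Definition irrelevant_ideal (k : closedFieldType) (f : cox k) : Prop :=
  ideal_gen (fun h => exists i, h = xvar k i) f /\
  ideal_gen (fun h => exists j, h = yvar k j) f.

(* A finitely generated Z^2-graded module F / N, where
   F = S(- gm_deg 0) (+) ... (+) S(- gm_deg (gm_rank - 1)) and the graded
   submodule N of F is given by its membership predicate gm_rel. *)
Record gmod (k : closedFieldType) := GMod {
  gm_rank : nat;
  gm_deg : 'I_gm_rank -> int * int;
  gm_rel : 'rV[cox k]_gm_rank -> Prop
}.

Definition quot_gmod (k : closedFieldType) (I : cox k -> Prop) : gmod k :=
  GMod (fun _ : 'I_1 => 0) (fun v => I (v ord0 ord0)).

Definition gm_homog (k : closedFieldType) (M : gmod k) (d : int * int)
  (v : 'rV[cox k]_(gm_rank M)) : Prop :=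
  forall j, bihomog (d - gm_deg j) (v ord0 j).

Definition zariski_open (k : closedFieldType) (U : P1xP1 k -> Prop) : Prop :=
  exists J : cox k -> Prop,
    (forall f, J f -> exists d, bihomog d f) /\
    (forall P, U P <-> exists2 f, J f & ~ vanishes_at f P).

(* The sheaf associated to a graded module M, as in the construction of the
   sheaf of a graded module on Proj: a section over U sends each P in U to an
   element of the degree-0 homogeneous localization M_(P), and is locally given
   by a single fraction.  Elements of M_(P) are represented by fractions m / s,
   up to the equality germ_eq.  Only closed points are used: open sets of the
   scheme correspond to their sets of closed points, and sections are determined
   by their germs there. *)
Record gfrac (k : closedFieldType) (M : gmod k) := GFrac {
  gnum : 'rV[cox k]_(gm_rank M);
  gden : cox k
}.

Definition is_germ (k : closedFieldType) (M : gmod k) (P : P1xP1 k)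
  (a : gfrac M) : Prop :=
  ~ vanishes_at (gden a) P /\
  exists d, gm_homog d (gnum a) /\ bihomog d (gden a).

Definition germ_eq (k : closedFieldType) (M : gmod k) (P : P1xP1 k)
  (a b : gfrac M) : Prop :=
  exists t, [/\ ~ vanishes_at t P, exists d, bihomog d t &
    gm_rel (t *: (gden b *: gnum a - gden a *: gnum b))].

Definition gfrac_add (k : closedFieldType) (M : gmod k) (a b : gfrac M) : gfrac M :=
  GFrac (gden b *: gnum a + gden a *: gnum b) (gden a * gden b).

(* The structure sheaf is the sheaf associated to S itself. *)
Definition struct_gmod (k : closedFieldType) : gmod k :=
  quot_gmod (fun f : cox k => f = 0).

Definition gfrac_scale (k : closedFieldType) (M : gmod k)
  (c : gfrac (struct_gmod k)) (a : gfrac M) : gfrac M :=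
  GFrac ((gnum c ord0 ord0 : cox k) *: gnum a) (gden c * gden a).

Definition is_section (k : closedFieldType) (M : gmod k) (U : P1xP1 k -> Prop)
  (s : P1xP1 k -> gfrac M) : Prop :=
  forall P, U P -> is_germ P (s P) /\
    exists (V : P1xP1 k -> Prop) (a : gfrac M),
      [/\ zariski_open V, V P, forall Q, V Q -> U Q &
        forall Q, V Q -> is_germ Q a /\ germ_eq Q (s Q) a].

Definition section_eq (k : closedFieldType) (M : gmod k) (U : P1xP1 k -> Prop)
  (s s' : P1xP1 k -> gfrac M) : Prop := forall P, U P -> germ_eq P (s P) (s' P).

(* A morphism between the O-modules associated to M and N; phi U is the map on
   sections over U, and only matters on sections up to section_eq. *)
Definition sheaf_hom (k : closedFieldType) (M N : gmod k)
  (phi : (P1xP1 k -> Prop) -> (P1xP1 k -> gfrac M) -> (P1xP1 k -> gfrac N))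
  : Prop :=
  [/\ forall U s, zariski_open U -> is_section U s -> is_section U (phi U s),
      forall U s s', zariski_open U -> is_section U s -> is_section U s' ->
        section_eq U s s' -> section_eq U (phi U s) (phi U s'),
      forall U s s', zariski_open U -> is_section U s -> is_section U s' ->
        section_eq U (phi U (fun P => gfrac_add (s P) (s' P)))
                     (fun P => gfrac_add (phi U s P) (phi U s' P)),
      forall U (c : P1xP1 k -> gfrac (struct_gmod k)) s,
        zariski_open U -> is_section U c -> is_section U s ->
        section_eq U (phi U (fun P => gfrac_scale (c P) (s P)))
                     (fun P => gfrac_scale (c P) (phi U s P)) &
      forall U V s, zariski_open U -> zariski_open V ->
        (forall P, V P -> U P) -> is_section U s ->
        section_eq V (phi V s) (phi U s)].

Definition sheaf_iso (k : closedFieldType) (M N : gmod k) : Prop :=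
  exists phi psi, [/\ @sheaf_hom k M N phi, @sheaf_hom k N M psi,
    forall U s, zariski_open U -> is_section U s ->
      section_eq U (psi U (phi U s)) s &
    forall U s, zariski_open U -> is_section U s ->
      section_eq U (phi U (psi U s)) s].

(* F_i is the direct sum of the S(- fc_deg j), j < fc_rank i.  Elements of F_i
   are row vectors, and fc_diff i is the matrix of phi_(i+1) : F_(i+1) -> F_i,
   acting on the right. *)
Record free_cplx (k : closedFieldType) := FreeCplx {
  fc_rank : nat -> nat;
  fc_deg : forall i, 'I_(fc_rank i) -> int * int;
  fc_diff : forall i, 'M[cox k]_(fc_rank i.+1, fc_rank i)
}.

Definition is_graded_cplx (k : closedFieldType) (F : free_cplx k) : Prop :=
  (forall i p q, bihomog (fc_deg p - fc_deg q) (fc_diff F i p q)) /\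
  (forall i, fc_diff F i.+1 *m fc_diff F i = 0).

(* The annihilator of H_(i+1)(F) = ker phi_(i+1) / im phi_(i+2). *)
Definition ann_homology (k : closedFieldType) (F : free_cplx k) (i : nat)
  (b : cox k) : Prop :=
  forall z : 'rV[cox k]_(fc_rank F i.+1), z *m fc_diff F i = 0 ->
  exists w : 'rV[cox k]_(fc_rank F i.+2), b *: z = w *m fc_diff F i.+1.

Definition coker_gmod (k : closedFieldType) (F : free_cplx k) : gmod k :=
  GMod (@fc_deg k F 0%N)
    (fun v => exists w : 'rV[cox k]_(fc_rank F 1), v = w *m fc_diff F 0%N).

Definition virtual_resolution (k : closedFieldType) (I : cox k -> Prop)
  (F : free_cplx k) : Prop :=
  [/\ is_graded_cplx F,
      forall i, exists l, (0 < l)%N /\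
        forall b, ideal_pow (@irrelevant_ideal k) l b -> ann_homology F i b &
      sheaf_iso (quot_gmod I) (coker_gmod F)].

(* The Koszul complex
     S <-(f, g)- S(-d) (+) S(-e) <-(-g, f)- S(-d-e) <- 0. *)
Definition koszul_deg (d e : int * int) (i : nat) : 'I_('C(2, i)) -> int * int :=
  match i with
  | 0 => fun=> 0
  | 1 => fun p => if val p == 0%N then d else e
  | _ => fun=> d + e
  end.

Definition koszul_diff (k : closedFieldType) (f g : cox k) (i : nat)
  : 'M[cox k]_('C(2, i.+1), 'C(2, i)) :=
  match i return 'M[cox k]_('C(2, i.+1), 'C(2, i)) with
  | 0 => \matrix_(p < 2, q < 1) (if val p == 0%N then f else g)
  | 1 => \matrix_(p < 1, q < 2) (if val q == 0%N then - g else f)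
  | _ => 0
  end.

Definition koszul (k : closedFieldType) (d e : int * int) (f g : cox k)
  : free_cplx k :=
  FreeCplx (fc_rank := fun i => 'C(2, i)) (koszul_deg d e) (koszul_diff f g).

Definition virtual_complete_intersection (k : closedFieldType)
  (X : {fset P1xP1 k}) : Prop :=
  exists (d e : int * int) (f g : cox k),
    [/\ bihomog d f, bihomog e g &
        virtual_resolution (point_ideal X) (koszul d e f g)].

(* Main.v *)
Require Import Defs.
From HB Require Import structures.
From mathcomp Require Import all_boot all_order all_algebra finmap mpoly.
From mathcomp Require Import ring.

(* Say that every vertical ruling meeting X does so in n points (the other case
   is symmetric).  Let L_p(x) be the linear form of the ruling over p, let f be
   the product of the L_p, let H_p = f / L_p, and let G_p(y) be the form of
   degree n cutting out the points of X over p.  All H_p G_p have the same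
   bidegree, and the Koszul complex of f and g = sum_p H_p G_p is the required
   virtual resolution.  Modulo L_p, g is H_p G_p, which is nonzero; hence f, g
   is a regular sequence.  If h vanishes on X then G_p divides h modulo L_p, so
   that H_p^2 h lies in (f, g), and f h always does; as f and the H_p^2 have no
   common zero, (f, g) and I_X define the same sheaf, the isomorphism being the
   identity on fractions. *)

Set Implicit Arguments.
Unset Strict Implicit.
Unset Printing Implicit Defensive.

Import GRing.Theory.
Local Open Scope ring_scope.

(** * Polynomials over an algebraically closed field as functions *)

(** Infinitude of [K]: it supplies more points than a given nonzero polynomial has roots. *)
Lemma closed_field_uniq (K : closedFieldType) n :
  exists2 s : seq K, size s = n & uniq s.
Proof.
elim: n => [|n [s <- s_uniq]]; first by exists [::].
have /closed_nonrootP[x] : \prod_(a <- s) ('X - a%:P) != 0.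
  exact: monic_neq0 (monic_prod_XsubC _ _ _).
rewrite root_prod_XsubC => x_notin.
by exists (x :: s); rewrite //= x_notin.
Qed.

Section SubstMPoly.
Variables (K : closedFieldType) (n : nat).
Implicit Types (f : {mpoly K[n]}) (i : 'I_n) (v : 'I_n -> K).

Definition subst1 (i : 'I_n) (c : K) (f : {mpoly K[n]}) : {mpoly K[n]} :=
  f \mPo [tuple if l == i then c%:MP else 'X_l | l < n].

Lemma subst1_eq0 i f : (forall c, subst1 i c f = 0) -> f = 0.
Proof.
move=> f0.
(* [f] as a polynomial in its [i]-th variable: it has all constants as roots. *)
pose U := mmap (polyC \o @mpolyC n K)
  (fun l : 'I_n => if l == i then 'X else ('X_l)%:P) f.
have evU (a : {mpoly K[n]}) :
    U.[a] = f \mPo [tuple if l == i then a else 'X_l | l < n].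
  rewrite /U [LHS]horner_sum comp_mpolyE; apply: eq_bigr => m _.
  rewrite hornerM /= hornerC mul_mpolyC; congr (_ *: _).
  rewrite /mmap1 horner_prod; apply: eq_bigr => l _.
  by rewrite horner_exp tnth_mktuple; case: eqP => _; rewrite ?hornerX ?hornerC.
have U0 : U = 0.
  have [s sz_s s_uniq] := closed_field_uniq K (size U).
  apply: (@roots_geq_poly_eq0 _ _ (map (@mpolyC n K) s)).
  - apply/allP => _ /mapP[c _ ->]; rewrite /root evU; exact/eqP/f0.
  - by rewrite map_inj_uniq // => a b /eqP; rewrite mpolyC_eq => /eqP.
  - by rewrite size_map sz_s.
(* Putting ['X_i] back for the variable of [U] recovers [f]. *)
have := evU 'X_i; rewrite U0 horner0 => ->.
rewrite -[LHS](comp_mpoly_id f); congr (_ \mPo _).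
by apply: eq_from_tnth => l; rewrite !tnth_mktuple; case: eqP => // ->.
Qed.

Lemma comp_mpoly_comp f (s t : n.-tuple {mpoly K[n]}) :
  (f \mPo s) \mPo t = f \mPo [tuple tnth s l \mPo t | l < n].
Proof.
rewrite [f \mPo s]comp_mpolyEX [RHS]comp_mpolyEX raddf_sum; apply: eq_bigr => m _ /=.
rewrite comp_mpolyZ !comp_mpolyX rmorph_prod /=; congr (_ *: _).
by apply: eq_bigr => l _; rewrite rmorphXn tnth_mktuple.
Qed.

(** Induction on the list [s] of variables set to constants: [subst1_eq0] frees them one by one, and
    with all of them set the substitution is evaluation. *)
Lemma meval_eq0 f : (forall v, f.@[v] = 0) -> f = 0.
Proof.
move=> f0.
have subst_eq0 (s : seq 'I_n) :
    (forall v, f \mPo [tuple if l \in s then (v l)%:MP else 'X_l | l < n] = 0) ->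
  f = 0.
  elim: s => [|i s IH] fs0.
    rewrite -[LHS](comp_mpoly_id f) -[RHS](fs0 (fun=> 0)).
    by congr (_ \mPo _).
  apply: IH => v; apply: (@subst1_eq0 i) => c.
  (* If [i] already lies in [s], its value is the one prescribed by [v], not [c]. *)
  rewrite -[RHS](fs0 (fun l => if l \in s then v l else c)) /subst1 comp_mpoly_comp.
  congr (_ \mPo _); apply: eq_from_tnth => l; rewrite !tnth_mktuple inE.
  case: ifP => ls; first by rewrite orbT comp_mpolyC.
  by rewrite orbF comp_mpolyXU -tnth_nth tnth_mktuple.
apply: (subst_eq0 (enum 'I_n)) => v; rewrite -[RHS](mpolyC0 n K) -(f0 v).
rewrite comp_mpolyEX mevalE rmorph_sum; apply: eq_bigr => m _ /=.
rewrite comp_mpolyX -mul_mpolyC rmorphM rmorph_prod /=; congr (_ * _).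
by apply: eq_bigr => l _; rewrite tnth_mktuple mem_enum rmorphXn.
Qed.

End SubstMPoly.

(** * Points of the projective line and their linear forms *)

Section HomogeneousCoordinates.
Variable k : closedFieldType.
Implicit Types p q : P1 k.

Definition coords p : 'rV[k]_2 := vpick (val p).

Lemma coords_neq0 p : coords p != 0.
Proof. by rewrite vpick0 -dimv_eq0 (eqP (valP p)). Qed.

Lemma P1E p : val p = <[coords p]>%VS.
Proof.
apply/esym/eqP; rewrite eqEdim dim_vline coords_neq0 (eqP (valP p)) andbT.
by rewrite -memvE memv_pick.
Qed.

Lemma coords_mem p : coords p \in val p.
Proof. exact: memv_pick. Qed.

(** A vanishing determinant makes the two vectors proportional; the factor is a quotient of entries
    taken where [coords q] is nonzero. *)
Lemma coords_det_eq0 p q :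
  (coords p ord0 0 * coords q ord0 1 - coords p ord0 1 * coords q ord0 0 == 0)
    = (p == q).
Proof.
apply/idP/eqP => [|->]; last by rewrite mulrC subrr.
rewrite subr_eq0 => /eqP det0; apply/val_inj.
rewrite P1E (P1E q).
have [c [c0 ->]] : exists c, c != 0 /\ coords p = c *: coords q.
  have := coords_neq0 p; have := coords_neq0 q; move: det0.
  move: (coords p) (coords q) => u v det0 v0 u0.
  have rowE (w : 'rV[k]_2) : w = \row_j (if j == 0 then w ord0 0 else w ord0 1).
    apply/rowP => j; rewrite mxE; case: eqP => [-> //|j0]; congr (w _ _).
    by apply/val_inj; case: j j0 => [[|[|]]] //= ? []; apply/val_inj.
  have [v00|v00] := eqVneq (v ord0 0) 0.
    have v10 : v ord0 1 != 0.
      apply: contra_neq v0 => v10; rewrite (rowE v) v00 v10.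
      by apply/rowP => j; rewrite !mxE if_same.
    have uE : u = (u ord0 1 / v ord0 1) *: v.
      apply/rowP => j; rewrite [u]rowE [X in _ *: X]rowE !mxE.
      case: eqP => _; last by rewrite divfK.
      move/eqP: det0; rewrite v00 !mulr0 mulf_eq0 (negPf v10) orbF => /eqP.
      by move->.
    exists (u ord0 1 / v ord0 1); split=> //.
    by apply: contra_neq u0 => c0; rewrite uE c0 scale0r.
  have uE : u = (u ord0 0 / v ord0 0) *: v.
    apply/rowP => j; rewrite [u]rowE [X in _ *: X]rowE !mxE.
    case: eqP => _; first by rewrite divfK.
    by apply: (mulIf v00); rewrite mulrAC divfK.
  exists (u ord0 0 / v ord0 0); split=> //.
  by apply: contra_neq u0 => c0; rewrite uE c0 scale0r.
apply/eqP; rewrite eqEdim !dim_vline scaler_eq0 (negPf c0) /= leqnn andbT.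
by rewrite -memvE memvZ // memv_line.
Qed.

End HomogeneousCoordinates.

Section PointForms.
Variables (k : closedFieldType) (n : nat) (i j : 'I_n).
Hypothesis ij : i != j.
Implicit Types (p q : P1 k) (h : {mpoly k[n]}) (v : 'I_n -> k).

(** The variables ['X_i] and ['X_j] are kept arbitrary so that the same forms serve both factors of
    the product. *)
Definition point_form p : {mpoly k[n]} :=
  coords p ord0 1 *: 'X_i - coords p ord0 0 *: 'X_j.

(* Any linear form taking the value 1 at [coords p] would do. *)
Definition point_coord p : {mpoly k[n]} :=
  if coords p ord0 0 != 0 then (coords p ord0 0)^-1 *: 'X_i
  else (coords p ord0 1)^-1 *: 'X_j.

(* The retraction onto the line of [p], with kernel generated by [point_form p]. *)
Definition restrict p h : {mpoly k[n]} :=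
  h \mPo [tuple if l == i then coords p ord0 0 *: point_coord p else
                if l == j then coords p ord0 1 *: point_coord p else 'X_l | l < n].

Lemma restrictD p : {morph restrict p : g h / g + h}.
Proof. exact: comp_mpolyD. Qed.

Lemma restrictB p : {morph restrict p : g h / g - h}.
Proof. exact: comp_mpolyB. Qed.

Lemma restrictM p : {morph restrict p : g h / g * h}.
Proof. by move=> g h; rewrite /restrict rmorphM. Qed.

Lemma restrict_prod p I (s : seq I) P (F : I -> {mpoly k[n]}) :
  restrict p (\prod_(a <- s | P a) F a) = \prod_(a <- s | P a) restrict p (F a).
Proof. by rewrite /restrict rmorph_prod. Qed.

Lemma restrictXU p l :
  restrict p 'X_l = if l == i then coords p ord0 0 *: point_coord p else
                    if l == j then coords p ord0 1 *: point_coord p else 'X_l.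
Proof. by rewrite /restrict comp_mpolyXU -tnth_nth tnth_mktuple. Qed.

Lemma coords1_neq0 p : coords p ord0 0 = 0 -> coords p ord0 1 != 0.
Proof.
move=> p0; apply: contra_neq (coords_neq0 p) => p1; apply/rowP => l.
rewrite [in RHS]mxE; have [->//|l0] := eqVneq l 0; rewrite -[RHS]p1.
by congr (coords p _ _); apply/val_inj; case: l l0 => [[|[|]]].
Qed.

Lemma point_coord_neq0 p : point_coord p != 0.
Proof.
rewrite /point_coord; have [p0|p0] := eqVneq (coords p ord0 0) 0 => /=;
  by rewrite -mul_mpolyC mulf_eq0 mpolyC_eq0 -msupp_eq0 msuppX orbF invr_eq0
    ?coords1_neq0.
Qed.

Lemma restrict_point_form p q :
  restrict p (point_form q) =
    (coords p ord0 0 * coords q ord0 1 - coords p ord0 1 * coords q ord0 0)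
    *: point_coord p.
Proof.
rewrite /point_form restrictB /restrict !comp_mpolyZ.
rewrite -![comp_mpoly _ _]/(restrict p _) !restrictXU eqxx eq_sym (negPf ij).
by rewrite eqxx !scalerA scalerBl mulrC [X in _ - X *: _]mulrC.
Qed.

Lemma restrict_point_form_eq0 p q :
  (restrict p (point_form q) == 0) = (p == q).
Proof.
rewrite restrict_point_form -mul_mpolyC mulf_eq0 mpolyC_eq0.
by rewrite (negPf (point_coord_neq0 p)) orbF coords_det_eq0.
Qed.

Lemma meval_restrict p h v (c := (point_coord p).@[v]) :
  (restrict p h).@[v] = h.@[fun l => if l == i then c * coords p ord0 0 else
                                     if l == j then c * coords p ord0 1 else v l].
Proof.
rewrite comp_mpoly_meval; apply: meval_eq => l; rewrite tnth_mktuple.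
by case: eqP => _; [|case: eqP => _]; rewrite ?mevalZ ?mevalXU // mulrC.
Qed.

(** Congruence modulo [point_form p] respects sums and products, so it suffices to treat the
    variables. *)
Lemma restrict_sub p h : exists c, h - restrict p h = c * point_form p.
Proof.
elim/mpolyind: h => [|a m h _ _ [c IH]].
  by exists 0; rewrite /restrict comp_mpoly0 mul0r subr0.
suff [d dE] : exists d, 'X_[m] - restrict p 'X_[m] = d * point_form p.
  exists (a%:MP * d + c); rewrite restrictD mulrDl -IH -mulrA -dE.
  rewrite /restrict comp_mpolyZ -!mul_mpolyC; ring.
rewrite mpolyXE_id; elim/big_ind: _ => [|f g [c1 E1] [c2 E2]|l _].
- by exists 0; rewrite /restrict comp_mpoly1 mul0r subrr.
- exists (c1 * g + restrict p f * c2).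
  by rewrite restrictM mulrDl -mulrA [g * _]mulrC mulrA -E1 -mulrA -E2; ring.
elim: (m l) => [|e [c1 E1]].
  by exists 0; rewrite expr0 /restrict comp_mpoly1 mul0r subrr.
suff [c2 E2] : exists c2, 'X_l - restrict p 'X_l = c2 * point_form p.
  exists (c2 * 'X_l ^+ e + restrict p 'X_l * c1).
  rewrite exprS restrictM mulrDl mulrAC -E2 -mulrA -E1; ring.
(* Of ['X_i] and ['X_j], the one defining [point_coord p] is fixed, and the other changes by a
   scalar multiple of [point_form p]. *)
rewrite restrictXU; have [->|li] := eqVneq l i.
  rewrite /point_coord /point_form; have [p0|p0] /= := eqVneq (coords p ord0 0) 0.
    exists (coords p ord0 1)^-1%:MP; rewrite p0 !scale0r !subr0 mul_mpolyC.
    by rewrite scalerA mulVf ?scale1r ?coords1_neq0.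
  by exists 0; rewrite scalerA divff // scale1r subrr mul0r.
have [->|lj] := eqVneq l j; last by exists 0; rewrite subrr mul0r.
rewrite /point_coord /point_form; have [p0|p0] /= := eqVneq (coords p ord0 0) 0.
  by exists 0; rewrite scalerA divff ?coords1_neq0 // scale1r subrr mul0r.
exists (- (coords p ord0 0)^-1)%:MP; rewrite mul_mpolyC scalerBr !scalerA !mulNr.
by rewrite mulVf // scaleN1r opprK scaleNr addrC mulrC.
Qed.

Lemma restrict_eq0 p h : restrict p h = 0 -> exists c, h = c * point_form p.
Proof.
by move=> h0; have [c cE] := restrict_sub p h; exists c; rewrite -cE h0 subr0.
Qed.

(** The forms are split off one at a time: those of the other points restrict to nonzero elements of
    a domain, so it is the cofactor that restricts to zero at [p]. *)
Lemma restrict_all_eq0 (s : seq (P1 k)) h : uniq s ->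
  (forall p, p \in s -> restrict p h = 0) ->
  exists c, h = c * \prod_(p <- s) point_form p.
Proof.
elim: s h => [|p s IH] h /=; first by exists h; rewrite big_nil mulr1.
case/andP=> ps s_uniq h0.
have [|c hE] := IH h s_uniq; first by move=> q qs; rewrite h0 // inE qs orbT.
have /eqP := h0 p (mem_head _ _); rewrite hE restrictM restrict_prod mulf_eq0.
rewrite prodf_seq_eq0; case: hasP => [[q qs /=]|_].
  by rewrite restrict_point_form_eq0 => /eqP pq; rewrite pq qs in ps.
rewrite orbF => /eqP /restrict_eq0[d cE].
by exists d; rewrite big_cons cE mulrA.
Qed.

Lemma point_form_neq0 p : point_form p != 0.
Proof.
have cX (a b : 'I_n) : ('X_a : {mpoly k[n]})@_U_(b) = (a == b)%:R.
  by rewrite mcoeffX eq_mnm1.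
apply: contra_neq (coords_neq0 p) => form0.
have p1 : coords p ord0 1 = 0.
  move/(congr1 (mcoeff U_(i))): form0; rewrite mcoeffB !mcoeffZ !cX eqxx.
  by rewrite eq_sym (negPf ij) mulr0 subr0 mulr1 mcoeff0.
have p0 : coords p ord0 0 = 0.
  move/(congr1 (mcoeff U_(j))): form0; rewrite mcoeffB !mcoeffZ !cX eqxx.
  by rewrite (negPf ij) mulr0 sub0r mulr1 mcoeff0 => /eqP; rewrite oppr_eq0 => /eqP.
by have := coords1_neq0 p0; rewrite p1 eqxx.
Qed.

End PointForms.

Section DisjointVariables.
Variables (k : closedFieldType) (n : nat) (i j i' j' : 'I_n).
Hypotheses (i'N : i' \notin [:: i; j]) (j'N : j' \notin [:: i; j]).
Implicit Types p q : P1 k.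

Lemma restrictXU_id p l : l \notin [:: i; j] -> restrict i j p 'X_l = 'X_l.
Proof. by rewrite restrictXU !inE negb_or => /andP[/negPf-> /negPf->]. Qed.

Lemma restrict_point_form_id p q :
  restrict i j p (point_form i' j' q) = point_form i' j' q.
Proof.
rewrite restrictB /restrict !comp_mpolyZ -![comp_mpoly _ _]/(restrict i j p _).
by rewrite !restrictXU_id.
Qed.

Lemma restrict_point_coord_id p q :
  restrict i j p (point_coord i' j' q) = point_coord i' j' q.
Proof.
rewrite /point_coord; case: ifP => _; rewrite /restrict comp_mpolyZ;
  by rewrite -[comp_mpoly _ _]/(restrict i j p _) restrictXU_id.
Qed.

End DisjointVariables.

(** * Bihomogeneous forms and associated sheaves *)

Section Bihomogeneous.
Variable k : closedFieldType.
Implicit Types (f g : cox k) (d e : int * int) (P : P1xP1 k).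

Lemma bidegD m1 m2 : bideg (m1 + m2)%MM = bideg m1 + bideg m2.
Proof.
have S (F : 'I_2 -> 'I_(2 + 2)) : (\sum_(i < 2) (m1 + m2)%MM (F i) =
    \sum_(i < 2) m1 (F i) + \sum_(i < 2) m2 (F i))%N.
  by rewrite -big_split; apply: eq_bigr => i _; rewrite mnmDE.
by rewrite /bideg !S !PoszD.
Qed.

Lemma bihomog0 d : bihomog d (0 : cox k).
Proof. by move=> m; rewrite msupp0. Qed.

Lemma bihomog1 : bihomog 0 (1 : cox k).
Proof.
move=> m; rewrite msupp1 inE => /eqP ->; rewrite /bideg.
by rewrite !big1 // => i _; rewrite mnm0E.
Qed.

Lemma bihomogD d f g : bihomog d f -> bihomog d g -> bihomog d (f + g).
Proof. by move=> fd gd m /msuppD_le; rewrite mem_cat => /orP[/fd|/gd]. Qed.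

Lemma bihomogN d f : bihomog d f -> bihomog d (- f).
Proof. by move=> fd m; rewrite (perm_mem (msuppN f)) => /fd. Qed.

Lemma bihomogZ d c f : bihomog d f -> bihomog d (c *: f).
Proof. by move=> fd m /msuppZ_le /fd. Qed.

Lemma bihomogM d e f g : bihomog d f -> bihomog e g -> bihomog (d + e) (f * g).
Proof.
by move=> fd ge m /msuppM_le /allpairsP[[m1 m2] /= [/fd <- /ge <- ->]]; rewrite bidegD.
Qed.

Lemma bihomog_sum d (I : eqType) (s : seq I) (F : I -> cox k) :
  {in s, forall i, bihomog d (F i)} -> bihomog d (\sum_(i <- s) F i).
Proof.
by move=> Fd; rewrite big_seq; elim/big_ind: _; [apply: bihomog0|apply: bihomogD|].
Qed.

Lemma bihomogX m : bihomog (bideg m) ('X_[m] : cox k).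
Proof. by move=> m'; rewrite msuppX inE => /eqP ->. Qed.

Lemma bihomog_prod d I (s : seq I) (F : I -> cox k) :
  (forall i, bihomog d (F i)) -> bihomog (d *+ size s) (\prod_(i <- s) F i).
Proof.
move=> Fd; elim: s => [|i s IH]; first by rewrite big_nil; apply: bihomog1.
by rewrite big_cons mulrS; apply: bihomogM.
Qed.

Lemma meval_bihomog d f (a b : k) (u v : 'rV[k]_2) : bihomog d f ->
  exists e : nat * nat, f.@[row_mx (a *: u) (b *: v) ord0] =
    a ^+ e.1 * b ^+ e.2 * f.@[row_mx u v ord0].
Proof.
(* If [d] has a negative component then [f] is zero, and the absolute values do no harm. *)
move=> fd; exists (absz d.1, absz d.2) => /=.
rewrite !mevalE mulr_sumr !big_seq; apply: eq_bigr => m /fd <- /=.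
rewrite [RHS]mulrCA; congr (_ * _); rewrite !big_split_ord /= mulrACA.
congr (_ * _); rewrite -prodrXr -big_split; apply: eq_bigr => l _ /=.
  by rewrite !row_mxEl mxE exprMn.
by rewrite !row_mxEr mxE exprMn.
Qed.

(** By bihomogeneity, rescaling the coordinates only rescales the value, so a single choice of
    representatives decides vanishing. *)
Lemma vanishes_atE d f P : bihomog d f ->
  vanishes_at f P <-> f.@[row_mx (coords P.1) (coords P.2) ord0] = 0.
Proof.
move=> fd; split=> [f0|f0 u v]; first by apply: f0; rewrite ?coords_mem ?coords_neq0.
rewrite !P1E => /vlineP[a ->] /vlineP[b ->] _ _.
by have [e ->] := meval_bihomog a b (coords P.1) (coords P.2) fd; rewrite f0 mulr0.
Qed.

Lemma vanishes_atM d e f g P : bihomog d f -> bihomog e g ->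
  ~ vanishes_at f P -> ~ vanishes_at g P -> ~ vanishes_at (f * g) P.
Proof.
move=> fd ge; rewrite (vanishes_atE _ fd) (vanishes_atE _ ge).
rewrite (vanishes_atE _ (bihomogM fd ge)) mevalM => /eqP f0 /eqP g0 /eqP.
by rewrite mulf_eq0 (negPf f0) (negPf g0).
Qed.

Lemma not_vanishes_at1 P : ~ vanishes_at 1 P.
Proof. by rewrite (vanishes_atE _ bihomog1) meval1; apply/eqP/oner_neq0. Qed.

End Bihomogeneous.

(** * Comparison of associated sheaves through their relations *)

Section Sheaves.
Variables (k : closedFieldType) (r : nat) (deg : 'I_r -> int * int).
Implicit Types (R : 'rV[cox k]_r -> Prop) (P : P1xP1 k).

(** Containment of relations after localization at every closed point; the multiplier may depend on
    the vector as well as on the point. *)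
Definition local_sub R1 R2 := forall P v, R1 v ->
  exists t d, [/\ bihomog d t, ~ vanishes_at t P & R2 (t *: v)].

Definition transport R1 R2 (U : P1xP1 k -> Prop)
    (s : P1xP1 k -> gfrac (GMod deg R1)) : P1xP1 k -> gfrac (GMod deg R2) :=
  fun P => @GFrac k (GMod deg R2) (gnum (s P)) (gden (s P)).

Lemma germ_eq_refl (M : gmod k) P (a : gfrac M) : gm_rel (0 : 'rV_(gm_rank M)) ->
  germ_eq P a a.
Proof.
move=> R0; exists 1; split; first exact: not_vanishes_at1.
  by exists 0; apply: bihomog1.
by rewrite subrr scaler0.
Qed.

(** Being a germ depends on the degrees alone, so only equality of germs has to be carried over: its
    multiplier [t] is replaced by [t' * t]. Compatibility with sums, scalars and restriction holds
    already on fractions. *)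
Lemma transport_sheaf_hom R1 R2 : R2 0 -> local_sub R1 R2 ->
  sheaf_hom (@transport R1 R2).
Proof.
move=> R20 R12.
have germ_eq12 P n1 d1 n2 d2 :
    germ_eq P (@GFrac k (GMod deg R1) n1 d1) (@GFrac k (GMod deg R1) n2 d2) ->
  germ_eq P (@GFrac k (GMod deg R2) n1 d1) (@GFrac k (GMod deg R2) n2 d2).
  case=> t [tP [d td] /= /(R12 P) [t' [d' [t'd t'P]]]]; rewrite scalerA => Rt.
  exists (t' * t); split=> //; first exact: vanishes_atM t'd td t'P tP.
  by exists (d' + d); apply: bihomogM.
split=> [U s _ sU P UP|U s s' _ _ _ ss' P UP|U s s' _ _ _ P UP|U c s _ _ _ P UP
       |U V s _ _ _ _ P UP].
- have [sP [V [a [Vo VP VU aV]]]] := sU P UP; split; first exact: sP.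
  exists V, (@GFrac k (GMod deg R2) (gnum a) (gden a)); split=> // Q /aV[aQ saQ].
  by split=> //; apply: germ_eq12; case: (s Q) (a) saQ => [? ?] [? ?].
- by apply: germ_eq12; case: (s P) (s' P) (ss' P UP) => [? ?] [? ?].
- exact: germ_eq_refl.
- exact: germ_eq_refl.
- exact: germ_eq_refl.
Qed.

Lemma local_sub_sheaf_iso R1 R2 : R1 0 -> R2 0 ->
  local_sub R1 R2 -> local_sub R2 R1 -> sheaf_iso (GMod deg R1) (GMod deg R2).
Proof.
move=> R10 R20 R12 R21; exists (@transport R1 R2), (@transport R2 R1).
split; try exact: transport_sheaf_hom.
  by move=> U s _ _ P _; rewrite /transport; case: (s P) => *; apply: germ_eq_refl.
by move=> U s _ _ P _; rewrite /transport; case: (s P) => *; apply: germ_eq_refl.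
Qed.

End Sheaves.

(** * Koszul complexes as virtual resolutions *)

Section KoszulCriterion.
Variable k : closedFieldType.
Implicit Types (f g : cox k) (d e : int * int).

Lemma koszul_graded_cplx d e f g : bihomog d f -> bihomog e g ->
  is_graded_cplx (koszul d e f g).
Proof.
move=> fd ge; split=> [[|[|i]] p q|[|i]] /=.
- by rewrite mxE subr0; case: ifP.
- rewrite mxE; case: ifP => _; first by rewrite addrAC subrr add0r; apply: bihomogN.
  by rewrite addrK.
- by rewrite mxE; apply: bihomog0.
- apply/matrixP => p q; rewrite !mxE !big_ord_recl big_ord0 !mxE /=; ring.
- by rewrite mul0mx.
Qed.

(** The syzygy hypothesis is exactness at [F_1], multiplication by the nonzero [f] is injective on
    [F_2], and the later terms have rank ['C(2, i)], which is 0. The higher homology is thus zero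
    and everything annihilates it. *)
Lemma koszul_exact d e f g : f != 0 ->
  (forall a b, a * f + b * g = 0 -> exists c, a = - (c * g) /\ b = c * f) ->
  forall i b, ann_homology (koszul d e f g) i b.
Proof.
move=> f0 syz [|[|i]] b z /= z0.
- have [|c [aE bE]] := syz (z ord0 0) (z ord0 1).
    move/matrixP/(_ ord0 ord0): z0; rewrite !mxE !big_ord_recl big_ord0 !mxE /= addr0.
    by move=> <-; congr (_ * _ + _ * _); congr (z _ _); apply/val_inj.
  exists (\row_(_ < 1) (b * c)); apply/rowP => j; rewrite !mxE big_ord1 !mxE.
  case: ifP => j0.
    have -> : j = 0 by apply/val_inj/eqP.
    rewrite aE; ring.
  have -> : j = 1 by apply/val_inj; case: j j0 => [[|[|]]].
  rewrite bE; ring.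
- exists 0; rewrite mul0mx; apply/rowP => j; rewrite [in RHS]mxE.
  move/matrixP/(_ ord0 1): z0; rewrite !mxE big_ord_recl big_ord0 !mxE /= addr0.
  move/eqP; rewrite mulf_eq0 (negPf f0) orbF => /eqP zj.
  by rewrite -[RHS](mulr0 b) -zj; congr (_ * z _ _); apply/val_inj; case: j => [[]].
- exists 0; apply/rowP => j; suff : (j < 0)%N by [].
  by apply: leq_trans (ltn_ord j) _; rewrite /= bin_small.
Qed.

(** The last hypothesis puts the ideal of [X] inside the ideal of [f] and [g] locally at each point;
    the reverse containment is global, with multiplier 1. *)
Lemma koszul_vci (X : {fset P1xP1 k}) d e f g :
  bihomog d f -> bihomog e g -> f != 0 ->
  (forall a b, a * f + b * g = 0 -> exists c, a = - (c * g) /\ b = c * f) ->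
  point_ideal X f -> point_ideal X g ->
  (forall P, exists t c, [/\ bihomog c t, ~ vanishes_at t P &
     forall h, point_ideal X h -> exists a b, t * h = a * f + b * g]) ->
  virtual_complete_intersection X.
Proof.
move=> fd ge f0 syz fX gX loc; exists d, e, f, g; split=> //; split.
- exact: koszul_graded_cplx.
- by move=> i; exists 1%N; split=> // b _; apply: koszul_exact.
apply: local_sub_sheaf_iso.
- by move=> P _ u v *; rewrite mxE meval0.
- by exists 0; rewrite mul0mx.
- move=> P v /= /[dup] vX; have [t [c [tc tP tX]]] := loc P => /tX[a [b E]].
  exists t, c; split=> //; exists (\row_(j < 2) if j == 0 then a else b).
  apply/rowP => j; rewrite !mxE !big_ord_recl big_ord0 !mxE /= addr0.
  by rewrite -E; congr (_ * v _ _); apply/val_inj; case: j => [[]].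
- move=> P v [w ->]; exists 1, 0; rewrite scale1r.
  split; [exact: bihomog1|exact: not_vanishes_at1|].
  move=> Q QX u v' uQ vQ u0 v0; rewrite !mxE !big_ord_recl big_ord0 !mxE /= addr0.
  by rewrite mevalD !mevalM (fX Q) // (gX Q) // !mulr0 addr0.
Qed.

End KoszulCriterion.

(** * The Koszul complex of a set of points *)

Section Construction.
Variables (k : closedFieldType) (X : {fset P1xP1 k}).
Implicit Types (s : bool) (p q : P1 k) (x P : P1xP1 k) (g h : cox k).

(** The boolean treats both kinds of rulings at once: [true] stands for the first factor and the
    variables x, [false] for the second factor and the variables y. *)
Definition factor s P : P1 k := if s then P.1 else P.2.
Definition block s (j : 'I_2) : 'I_(2 + 2) := if s then lshift 2 j else rshift 2 j.
Definition unit_deg s : int * int := if s then (1, 0) else (0, 1).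
Definition ruling s p : cox k := point_form (block s 0) (block s 1) p.
Definition restr s p : cox k -> cox k := restrict (block s 0) (block s 1) p.

Lemma restrD s p g h : restr s p (g + h) = restr s p g + restr s p h.
Proof. exact: restrictD. Qed.

Lemma restrM s p g h : restr s p (g * h) = restr s p g * restr s p h.
Proof. exact: restrictM. Qed.

Lemma block_neq s : block s 0 != block s 1.
Proof. by case: s. Qed.

Lemma block_notin s t j : s != t -> block t j \notin [:: block s 0; block s 1].
Proof. by case: s t => [] [] //; case: j => [[|[|]]]. Qed.

Lemma bihomog_ruling s p : bihomog (unit_deg s) (ruling s p).
Proof.
have bX j : bihomog (unit_deg s) ('X_(block s j) : cox k).
  have -> : unit_deg s = bideg U_(block s j); last exact: bihomogX.
  rewrite /bideg !big_ord_recl !big_ord0 !mnmE.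
  by case: s; case: j => [[|[|]]].
by apply: bihomogD; [|apply: bihomogN]; apply: bihomogZ.
Qed.

Lemma factor_inj s x y : factor s x = factor s y ->
  factor (~~ s) x = factor (~~ s) y -> x = y.
Proof. by case: s x y => [] [? ?] [? ?] /= -> ->. Qed.

Lemma meval_coords s p x (P := row_mx (coords x.1) (coords x.2)) :
  ((ruling s p).@[P ord0] == 0) = (factor s x == p).
Proof.
rewrite -coords_det_eq0 /ruling /point_form mevalB !mevalZ !mevalXU.
rewrite [X in X - _]mulrC [X in _ - X]mulrC.
by case: s; rewrite /block /P ?row_mxEl ?row_mxEr.
Qed.

Lemma ruling_vanishes s x : vanishes_at (ruling s (factor s x)) x.
Proof.
by rewrite (vanishes_atE _ (@bihomog_ruling s _)); apply/eqP; rewrite meval_coords.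
Qed.

(** The values of the double restriction are values of [h] at rescaled coordinates of [x]. They are
    known to vanish only for nonzero scaling factors; multiplying by [c] and [c'], which are nonzero
    polynomials giving these factors, disposes of the other cases. *)
Lemma restr_restr_eq0 s h x : vanishes_at h x ->
  restr (~~ s) (factor (~~ s) x) (restr s (factor s x) h) = 0.
Proof.
move=> hx.
pose c := point_coord (block s 0) (block s 1) (factor s x).
pose c' := point_coord (block (~~ s) 0) (block (~~ s) 1) (factor (~~ s) x).
suff /eqP : restr (~~ s) (factor (~~ s) x) (restr s (factor s x) h * c) * c' = 0.
  rewrite /restr restrictM restrict_point_coord_id ?block_notin; try by case: (s).
  by rewrite !mulf_eq0 !(negPf (point_coord_neq0 _ _ _)) !orbF => /eqP.
apply: meval_eq0 => v; rewrite mevalM meval_restrict -/c'.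
have [-> |c'0] := eqVneq c'.@[v] 0; first by rewrite mulr0.
set v1 := (fun=> _); rewrite mevalM meval_restrict -/c.
have [-> |] := eqVneq c.@[v1] 0; first by rewrite mulr0 mul0r.
move: c.@[v1] => e e0; move: c'.@[v] c'0 @v1 => e' e'0 v1.
(* [e] scales the coordinates in factor [s] and [e'] those in the other; [a] and [b] put them in the
   order of the factors. *)
pose a := if s then e else e'.
pose b := if s then e' else e.
rewrite -mulrA (_ : h.@[_] = h.@[row_mx (a *: coords x.1) (b *: coords x.2) ord0]).
  rewrite hx ?mul0r ?memvZ ?coords_mem //.
    by rewrite scaler_eq0 negb_or coords_neq0 andbT /a; case: (s).
  by rewrite scaler_eq0 negb_or coords_neq0 andbT /b; case: (s).
apply: meval_eq => l; rewrite /v1 /a /b.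
case: (split_ordP l) => j ->; rewrite ?row_mxEl ?row_mxEr mxE;
  case: (s); case: j => [[|[|]]] //= j2; congr (_ * coords _ _ _); exact: val_inj.
Qed.

Variables (s : bool) (n : nat).

Definition bases := undup [seq factor s x | x <- X].
Definition fibre p := [seq factor (~~ s) x | x <- X & factor s x == p].

Hypothesis fibre_size : forall p, p \in bases -> size (fibre p) = n.

(** [baseform], [cobaseform p], [fibreform p] and [interpolant] are the f, H_p, G_p and g of the
    opening sketch. *)
Definition baseform : cox k := \prod_(p <- bases) ruling s p.
Definition cobaseform p : cox k := \prod_(q <- rem p bases) ruling s q.
Definition fibreform p : cox k := \prod_(q <- fibre p) ruling (~~ s) q.
Definition interpolant : cox k := \sum_(p <- bases) cobaseform p * fibreform p.

Lemma fibre_uniq p : uniq (fibre p).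
Proof.
rewrite map_inj_in_uniq ?filter_uniq ?fset_uniq // => x y.
rewrite !mem_filter => /andP[/eqP px _] /andP[/eqP py _]; apply: factor_inj.
by rewrite px py.
Qed.

Lemma bases_factor x : x \in X -> factor s x \in bases.
Proof. by move=> xX; rewrite mem_undup map_f. Qed.

Lemma fibreP p q :
  reflect (exists x, [/\ x \in X, factor s x = p & factor (~~ s) x = q])
          (q \in fibre p).
Proof.
apply: (iffP mapP) => [[x]|[x [xX px qx]]].
  by rewrite mem_filter => /andP[/eqP px xX] ->; exists x.
by exists x => //; rewrite mem_filter px eqxx.
Qed.

Lemma baseformE p : p \in bases -> baseform = cobaseform p * ruling s p.
Proof. by move=> pA; rewrite /baseform (big_rem p) //= mulrC. Qed.

Lemma bihomog_baseform : bihomog (unit_deg s *+ size bases) baseform.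
Proof. by apply: bihomog_prod => p; apply: bihomog_ruling. Qed.

Lemma bihomog_cobaseform p : p \in bases ->
  bihomog (unit_deg s *+ (size bases).-1) (cobaseform p).
Proof.
by move=> pA; rewrite -(size_rem pA); apply: bihomog_prod => q; apply: bihomog_ruling.
Qed.

(** Equidistribution enters here: fibres of equal size make all summands of the same bidegree. *)
Lemma bihomog_interpolant :
  bihomog (unit_deg s *+ (size bases).-1 + unit_deg (~~ s) *+ n) interpolant.
Proof.
apply: bihomog_sum => p pA; apply: bihomogM; first exact: bihomog_cobaseform.
by rewrite -(fibre_size pA); apply: bihomog_prod => q; apply: bihomog_ruling.
Qed.

Lemma baseform_neq0 : baseform != 0.
Proof.
by rewrite prodf_seq_neq0; apply/allP => p _; apply/point_form_neq0/block_neq.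
Qed.

Lemma restr_ruling_eq0 p q : (restr s p (ruling s q) == 0) = (p == q).
Proof. exact: restrict_point_form_eq0 (block_neq s) p q. Qed.

Lemma restr_fibreform p r : restr s p (fibreform r) = fibreform r.
Proof.
rewrite /restr restrict_prod; apply: eq_bigr => q _.
by apply: restrict_point_form_id; apply: block_notin; case: (s).
Qed.

Lemma fibreform_neq0 p : fibreform p != 0.
Proof.
by rewrite prodf_seq_neq0; apply/allP => q _; apply/point_form_neq0/block_neq.
Qed.

Lemma restr_cobaseform_neq0 p : restr s p (cobaseform p) != 0.
Proof.
rewrite /restr restrict_prod prodf_seq_neq0; apply/allP => q.
rewrite mem_rem_uniq ?undup_uniq // => /andP[/= qp _].
by rewrite -/(restr _ _ _) restr_ruling_eq0 eq_sym.
Qed.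

(** For [q] in [bases] other than [p], [cobaseform q] contains the factor [ruling s p], so only the
    summand of [p] survives modulo that form. *)
Lemma interpolantE p : p \in bases ->
  exists c, interpolant = cobaseform p * fibreform p + c * ruling s p.
Proof.
move=> pA; rewrite /interpolant (big_rem p) //=.
set S := \sum_(q <- rem p bases) _; suff /restrict_eq0[c ->] : restr s p S = 0.
  by exists c.
rewrite /restr /restrict raddf_sum big_seq big1 // => q.
rewrite mem_rem_uniq ?undup_uniq // => /andP[/= qp _].
rewrite -/(restrict _ _ _ _) restrictM /cobaseform (big_rem p) /=; last first.
  by rewrite mem_rem_uniq ?undup_uniq // inE /= eq_sym qp.
rewrite restrictM -/(restr _ _ _).
have /eqP -> : restr s p (ruling s p) == 0 by rewrite restr_ruling_eq0.
by rewrite !mul0r.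
Qed.

Lemma baseform_point_ideal : point_ideal X baseform.
Proof.
move=> x xX u v ux vx u0 v0; rewrite (baseformE (bases_factor xX)) mevalM.
by rewrite (ruling_vanishes s) // mulr0.
Qed.

Lemma interpolant_point_ideal : point_ideal X interpolant.
Proof.
move=> x xX u v ux vx u0 v0; have [c ->] := interpolantE (bases_factor xX).
rewrite mevalD !mevalM (ruling_vanishes s) // mulr0 addr0 /fibreform.
rewrite (big_rem (factor (~~ s) x)) /=; last by apply/fibreP; exists x.
by rewrite mevalM (ruling_vanishes (~~ s)) // mul0r mulr0.
Qed.

(** Modulo each [ruling s p] the relation loses its first term, and [interpolant] becomes nonzero;
    so [b] restricts to zero on all these rulings and is a multiple of [baseform], which can then be
    cancelled. *)
Lemma interpolant_syzygy (a b : cox k) : a * baseform + b * interpolant = 0 ->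
  exists c, a = - (c * interpolant) /\ b = c * baseform.
Proof.
move=> ab0; have [|c bE] :=
  restrict_all_eq0 (s := bases) (block_neq s) (undup_uniq _) (h := b).
  move=> p pA; have [c gE] := interpolantE pA.
  have /eqP r0 : restr s p (ruling s p) == 0 by rewrite restr_ruling_eq0.
  move/(congr1 (restr s p)): ab0; rewrite (baseformE pA) gE.
  rewrite restrD 2!restrM r0 !mulr0 add0r restrM restrD !restrM r0 mulr0 addr0.
  rewrite restr_fibreform {3}/restr /restrict comp_mpoly0 => /eqP.
  rewrite !mulf_eq0 (negPf (restr_cobaseform_neq0 p)) (negPf (fibreform_neq0 p)).
  by rewrite !orbF => /eqP.
rewrite -/baseform in bE; exists c; split=> //; apply/eqP; rewrite -addr_eq0.
apply/eqP/(mulIf baseform_neq0); rewrite mul0r -ab0 bE; ring.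
Qed.

(** On the ruling of [p], [h] vanishes at the points of the fibre, hence is a multiple of
    [fibreform p]; this gives h = c L_p + c' G_p. *)
Lemma cobaseform_point_ideal p h : p \in bases -> point_ideal X h ->
  exists a b, cobaseform p * cobaseform p * h = a * baseform + b * interpolant.
Proof.
move=> pA hX; have [d gE] := interpolantE pA.
have [c hE] := restrict_sub (block s 0) (block s 1) p h.
have [|c' rE] :=
  restrict_all_eq0 (block_neq (~~ s)) (fibre_uniq p) (h := restr s p h).
  by move=> _ /fibreP[x [xX <- <-]]; apply: restr_restr_eq0; apply: hX.
(* One factor H_p turns G_p into g - d L_p; the other turns the remaining multiples of L_p into
   multiples of f. *)
exists (cobaseform p * c - c' * d), (c' * cobaseform p).
rewrite (baseformE pA) gE.
have -> : h = c * ruling s p + c' * fibreform p by rewrite -hE -rE subrK.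
ring.
Qed.

(** The local multiplier at [P] is H_p squared if [P] lies on the ruling of some [p] in [bases], and
    f itself otherwise. *)
Lemma construction_vci : virtual_complete_intersection X.
Proof.
apply: koszul_vci bihomog_baseform bihomog_interpolant baseform_neq0
  interpolant_syzygy baseform_point_ideal interpolant_point_ideal _ => P.
have [pA|pA] := boolP (factor s P \in bases).
  set H := cobaseform (factor s P).
  have Hd := bihomog_cobaseform pA; exists (H * H); eexists; split.
  - exact: (bihomogM Hd Hd).
  - suff HP : ~ vanishes_at H P by apply: (vanishes_atM Hd Hd HP HP).
    rewrite (vanishes_atE _ Hd) rmorph_prod; apply/eqP; rewrite prodf_seq_neq0.
    apply/allP => q; rewrite mem_rem_uniq ?undup_uniq // => /andP[/= qp _].
    by rewrite meval_coords eq_sym.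
  - by move=> h; apply: cobaseform_point_ideal.
exists baseform; eexists; split; first exact: bihomog_baseform.
  rewrite (vanishes_atE _ bihomog_baseform) rmorph_prod; apply/eqP.
  rewrite prodf_seq_neq0; apply/allP => q qA.
  by rewrite meval_coords; apply: contraNneq pA => ->.
by move=> h _; exists h, 0; rewrite mul0r addr0 mulrC.
Qed.

End Construction.

Theorem theorem3p1 (k : closedFieldType) (X : {fset P1xP1 k})
  (X_neq0 : X <> fset0)
  (X_equidistributed :
    (forall p p' : P1 k, (0 < vertical_count X p)%N ->
       (0 < vertical_count X p')%N -> vertical_count X p = vertical_count X p')
    \/
    (forall q q' : P1 k, (0 < horizontal_count X q)%N ->
       (0 < horizontal_count X q')%N ->
       horizontal_count X q = horizontal_count X q')) :
  virtual_complete_intersection X.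
Proof.
have [x xX] : exists x, x \in X by apply/fset0Pn/eqP.
have vci s (count : P1 k -> nat) : (forall p, size (fibre X s p) = count p) ->
    (forall p q, (0 < count p)%N -> (0 < count q)%N -> count p = count q) ->
  virtual_complete_intersection X.
  (* The common number of points is read off on the ruling through [x], which exists as [X] is
     nonempty. *)
  move=> countE eq_count; apply: (@construction_vci k X s (count (factor s x))) => p.
  have pos y : y \in X -> (0 < count (factor s y))%N.
    move=> yX; have : factor (~~ s) y \in fibre X s (factor s y).
      by apply/fibreP; exists y.
    by rewrite -countE; case: (fibre _ _ _).
  by rewrite countE mem_undup => /mapP[y yX ->]; apply: eq_count; apply: pos.
case: X_equidistributed; [apply: (vci true)|apply: (vci false)] => p.
  rewrite size_map; apply/perm_size/uniq_perm; rewrite ?filter_uniq ?fset_uniq //.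
  by move=> y; rewrite mem_filter !inE andbC.
rewrite size_map; apply/perm_size/uniq_perm; rewrite ?filter_uniq ?fset_uniq //.
by move=> y; rewrite mem_filter !inE andbC.
Qed.
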